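(* Let $t\ge 2$ be an integer. Then $$\lim_{k\to\infty}\frac{AE(k,t)}{k}=\lim_{k\to\infty}\max\left\{\frac{\alpha_{t-1}(G)}{k}: G \text{ is a connected graph of order } k\right\}.$$
   Context: Graphs are finite, simple and undirected; the order is the number of vertices; $d(u,v)$ is the shortest-path distance. For $s\ge 1$, a set $U\subseteq V(G)$ is $s$-independent if $d(u,v)>s$ for all distinct $u,v\in U$, and $\alpha_s(G)$ is the maximum size of an $s$-independent set. A set $S\subseteq V(G)$ is $t$-equidistant if $d(u,v)=t$ for all distinct $u,v\in S$, and $\mathrm{eq}_t(G)$ is the maximum size of a $t$-equidistant set. For $k\ge1$ and $t\ge2$, $AE(k,t)=\max\{\alpha_{t-1}(G)-\mathrm{eq}_t(G): G \text{ a connected graph of order } k\}$. *)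

(* Defs.v *)
From HB Require Import structures.
From mathcomp Require Import all_boot.

Set Implicit Arguments.
Unset Strict Implicit.
Unset Printing Implicit Defensive.

Record sgraph (T : finType) := SGraph {
  edges :> {set T * T};
  sgraphP : [forall x, (x, x) \notin edges]
            && [forall x, forall y, ((x, y) \in edges) == ((y, x) \in edges)]
}.

HB.instance Definition _ (T : finType) := [isSub for @edges T].
HB.instance Definition _ (T : finType) := [Finite of sgraph T by <:].

Section Defs.
Variable T : finType.
Implicit Types (G : sgraph T) (U S : {set T}).

Definition adj G : rel T := fun x y => (x, y) \in edges G.

Lemma adj_irrefl G : irreflexive (adj G).
Proof.
by move=> x; apply/negbTE; have /andP[/forallP/(_ x)] := sgraphP G.
Qed.

Lemma adj_sym G : symmetric (adj G).
Proof.
by move=> x y; have /andP[_ /forallP/(_ x)/forallP/(_ y)/eqP] := sgraphP G.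
Qed.

Definition gconnected G : bool := [forall u, forall v, connect (adj G) u v].

Definition has_walk G (u v : T) (n : nat) : bool :=
  [exists p : n.-tuple T, path (adj G) u p && (last u p == v)].

(* The least length of a walk from u to v; a shortest walk has fewer than #|T|
   edges.  If v is not reachable from u, the value is the junk value #|T|. *)
Definition dist G (u v : T) : nat := find (has_walk G u v) (iota 0 #|T|).

Lemma dist_walk G u v : connect (adj G) u v ->
  exists p : seq T, [/\ path (adj G) u p, last u p = v & size p = dist G u v].
Proof.
case/connectP => q /shortenP[p pp up _] ->.
have sp : size p < #|T|.
  by rewrite -[leqLHS]/(size (u :: p)) -(card_uniqP up) max_card.
have hw : has (has_walk G u (last u p)) (iota 0 #|T|).
  apply/hasP; exists (size p); first by rewrite mem_iota.
  by apply/existsP; exists (in_tuple p); rewrite pp /=.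
have lt := hw; rewrite has_find size_iota in lt.
have := nth_find 0 hw; rewrite nth_iota // add0n => /existsP[r /andP[pr /eqP lr]].
by exists r; split=> //; rewrite size_tuple.
Qed.

Lemma dist_le_walk G u v (p : seq T) : path (adj G) u p -> last u p = v ->
  dist G u v <= size p.
Proof.
move=> pp lp; have [sp|sp] := ltnP (size p) #|T|; last first.
  by apply: leq_trans sp; rewrite /dist -[leqRHS](size_iota 0) find_size.
rewrite leqNgt; apply/negP => /(before_find 0).
rewrite nth_iota // add0n => /negbT/negP; apply.
by apply/existsP; exists (in_tuple p); rewrite pp lp /=.
Qed.

Definition independent (s : nat) G U : bool :=
  [forall u in U, forall v in U, (u != v) ==> (s < dist G u v)].

Definition equidistant (t : nat) G S : bool :=
  [forall u in S, forall v in S, (u != v) ==> (dist G u v == t)].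

Definition alpha (s : nat) G : nat := \max_(U : {set T} | independent s G U) #|U|.

Definition eqt (t : nat) G : nat := \max_(S : {set T} | equidistant t G S) #|S|.

Lemma eqt_le_alpha (t : nat) G : 0 < t -> eqt t G <= alpha t.-1 G.
Proof.
move=> t0; apply/bigmax_leqP => S eS.
apply: (@leq_bigmax_cond _ _ (fun U : {set T} => #|U|)).
apply/forall_inP => u uS; apply/forall_inP => v vS; apply/implyP => uv.
by move: eS => /forall_inP/(_ u uS)/forall_inP/(_ v vS)/implyP/(_ uv)/eqP ->;
  rewrite prednK.
Qed.

End Defs.

(* Up to isomorphism a graph of order k has vertex set 'I_k.  The difference of
   naturals is never truncated for t > 0, by eqt_le_alpha.  For k > 0 connected graphs of
   order k exist, so the default value 0 of the big operator plays no role. *)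
Definition AE (k t : nat) : nat :=
  \max_(G : sgraph 'I_k | gconnected G) (alpha t.-1 G - eqt t G).

(* Main.v *)
(* Both limits equal 1/c with c = uphalf t.  If vertices of a connected graph
   are pairwise at distance at least t, the balls of radius c - 1 around them
   are disjoint, and each contains at least c vertices; hence
   c alpha_{t-1} <= k + c.  Conversely, take spiders with n legs of c vertices
   and string their hubs along a path.  Leg tips are at mutual distance at least
   2c >= t, so alpha_{t-1} is asymptotically at least n k / ((n + 1) c), while
   the position along the path is 1-Lipschitz, so an equidistant set meets a
   bounded number of spiders and eq_t is bounded independently of k.  Then let n
   tend to infinity. *)
Require Import Defs.
From mathcomp Require Import all_boot all_order all_algebra.
From mathcomp Require Import all_classical all_reals all_analysis.
From mathcomp Require Import zify ring lra.
Import Order.TTheory GRing.Theory Num.Theory.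
Import numFieldNormedType.Exports.
Local Open Scope classical_set_scope.

(** * Distances, and the upper bound for independent sets *)

Section Distance.
Variables (T : finType) (G : sgraph T).
Hypothesis connG : gconnected G.

Lemma gconnected_connect (u v : T) : connect (adj G) u v.
Proof. by have /forallP/(_ u)/forallP/(_ v) := connG. Qed.

(** Source of all lower bounds on distances in the tree: each step of a shortest walk raises the
    potential [f] by at most one. *)
Lemma lipschitz_dist (f : T -> nat) (u v : T) :
  (forall x y, adj G x y -> f y <= (f x).+1) -> f v <= f u + dist G u v.
Proof.
move=> lipf; have [p [pp <- <-]] := dist_walk (gconnected_connect u v).
elim: p u pp => [|x p IHp] u /=; first by rewrite addn0.
case/andP=> /lipf ux /IHp; lia.
Qed.

(** Both distances end at [x], as suits two balls meeting there; the walk from [v] is reversed. *)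
Lemma dist_via (u v x : T) : dist G u v <= dist G u x + dist G v x.
Proof.
have [p [pp lp <-]] := dist_walk (gconnected_connect u x).
have [q [pq lq <-]] := dist_walk (gconnected_connect v x).
pose r := rev (belast v q).
have pr : path (adj G) x r.
  rewrite /r -lq rev_path (@eq_path _ _ (adj G)) // => a b; exact: adj_sym.
have lr : last x r = v.
  by rewrite /r; case: (q) lq => [|y q'] //= _; rewrite rev_cons last_rcons.
rewrite -(size_belast v q) -(size_rev (belast v q)) -size_cat.
by apply: dist_le_walk; rewrite ?cat_path ?last_cat lp ?pp.
Qed.

(** The first [c] vertices of a simple path from [u] to [v] lie in the ball, the one at index i
    being reached by a prefix of length i. *)
Lemma card_ball (c : nat) (u v : T) :
  c <= dist G u v -> c <= #|[set x | dist G u x < c]%SET|.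
Proof.
move=> le_c; case/connectP: (gconnected_connect u v) => q.
case/shortenP=> p pp up _ lp.
have c_p : c <= size p by apply: leq_trans le_c (dist_le_walk pp _).
have size_t : size (take c (u :: p)) = c by rewrite size_takel //= ltnW.
rewrite -[leqLHS]size_t cardE; apply: uniq_leq_size; first exact: take_uniq.
move=> x xt; have xp := mem_take xt.
rewrite mem_enum inE; have i_c : index x (u :: p) < c by rewrite index_ltn.
apply: leq_ltn_trans i_c.
have := nth_index u xp; case: (index x (u :: p)) (index_mem x (u :: p)) => [|i].
  by move=> _ /= <-; exact: (@dist_le_walk _ G u u [::]).
rewrite xp /= ltnS => i_p nx.
have -> : i.+1 = size (take i.+1 p) by rewrite size_takel.
apply: dist_le_walk; first exact: take_path.
by rewrite (last_nth u) size_takel //= nth_take.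
Qed.

Lemma alpha_upper (t : nat) :
  0 < t -> alpha t.-1 G * uphalf t <= #|T| + uphalf t.
Proof.
move=> t0; set c := uphalf t.
have c0 : 0 < c by rewrite /c; lia.
suff H (U : {set T}) : independent t.-1 G U -> #|U| <= (#|T| + c) %/ c.
  by rewrite -leq_divRL //; apply/bigmax_leqP => U; exact: H.
move=> /forall_inP indU; rewrite leq_divRL //.
have far (u v : T) : u \in U -> v \in U -> u != v -> t <= dist G u v.
  by move=> /indU/forall_inP h /h/implyP h' /h'; rewrite prednK.
(* The additive [c] pays for this case, where no second vertex of [U] forces a ball to be large. *)
have [U1|] := leqP #|U| 1; first by nia.
move=> /card_gt1P[a [b [aU bU ab]]].
pose B u := [set x | dist G u x < c]%SET.
have cB u : u \in U -> c <= #|B u|.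
  move=> uU; have [v vU uv] : exists2 v, v \in U & u != v.
    have [ua|ua] := eqVneq u a; last by exists a.
    by exists b => //; rewrite ua.
  apply: (@card_ball c u v); apply: leq_trans (far _ _ uU vU uv).
  rewrite /c; lia.
apply: leq_trans (leq_addr _ _).
rewrite -sum_nat_const; apply: (leq_trans (leq_sum _ cB)).
(* Double counting: each [x] lies in at most one ball, because 2(c - 1) < t. *)
under eq_bigr do rewrite -sum1dep_card.
under eq_bigr do rewrite big_mkcond.
rewrite exchange_big /= -sum1_card; apply: leq_sum => x _.
rewrite -big_mkcondr sum1dep_card /=; apply/card_le1_eqP => u v.
rewrite !inE => /andP[uU ux] /andP[vU vx]; apply/eqP; apply: contraT => uv.
have := far _ _ uU vU; rewrite eq_sym uv => /(_ isT).
have := dist_via u v x; move: ux vx; rewrite /c; lia.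
Qed.

End Distance.

(** * The string of spiders *)

Section Tree.
Variables c n : nat.
Hypothesis c0 : 0 < c.

(* Legs are the runs [q c, (q + 1) c); the legs with n.+1 %| q are hubs.  The
   root of a leg hangs from the root of the last hub strictly before it. *)
Definition parent (v : nat) : nat :=
  if v %% c == 0 then (v %/ c).-1 %/ n.+1 * n.+1 * c else v.-1.

Lemma parent_lt v : 0 < v -> parent v < v.
Proof.
rewrite /parent; case: ifP => [/eqP v0|_]; last by case: v.
move=> vpos; rewrite [ltnRHS](divn_eq v c) v0 addn0 ltn_pmul2r //.
apply: leq_ltn_trans (leq_trunc_div _ _) _; rewrite ltn_predL lt0n.
by apply: contraTneq vpos => q0; rewrite (divn_eq v c) v0 q0.
Qed.

Lemma parent_nonroot v :
  v %% c != 0 -> (parent v) %/ c = v %/ c /\ v %% c = ((parent v) %% c).+1.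
Proof.
move=> v0; rewrite /parent (negbTE v0).
have e : v.-1 = v %/ c * c + (v %% c).-1.
  move: v0; rewrite [in v.-1](divn_eq v c); case: (v %% c) => // r _.
  by rewrite addnS.
have lt : (v %% c).-1 < c by exact: leq_ltn_trans (leq_pred _) (ltn_pmod v c0).
rewrite e divnMDl // modnMDl (divn_small lt) (modn_small lt) addn0.
by rewrite prednK ?lt0n.
Qed.

Lemma parent_root v :
  v %% c = 0 -> (parent v) %/ c = (v %/ c).-1 %/ n.+1 * n.+1.
Proof. by move=> v0; rewrite /parent v0 eqxx mulnK. Qed.

(** [parent] fixes 0, so the inequality removes a loop there. *)
Definition tree_edges k : {set 'I_k * 'I_k} :=
  [set e : 'I_k * 'I_k |
    (e.1 != e.2) && ((parent e.1 == e.2) || (parent e.2 == e.1))]%SET.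

Fact tree_subproof k :
  [forall x, (x, x) \notin tree_edges k] &&
  [forall x, forall y, ((x, y) \in tree_edges k) == ((y, x) \in tree_edges k)].
Proof.
apply/andP; split; first by apply/forallP => x; rewrite inE eqxx.
by apply/forallP => x; apply/forallP => y; rewrite !inE /= [x == y]eq_sym orbC.
Qed.

Definition tree k : sgraph 'I_k := SGraph (tree_subproof k).

Lemma tree_adj k (x y : 'I_k) :
  adj (tree k) x y -> parent x = y \/ parent y = x.
Proof.
by rewrite /adj inE /= => /andP[_ /orP[]/eqP]; [left | right].
Qed.

(** Parents have smaller labels, so iterating [parent] stays below [k] and ends at 0. *)
Lemma tree_connected k : gconnected (tree k).
Proof.
case: k => [|k]; first by apply/forallP => -[].
have to0 (x : 'I_k.+1) : connect (adj (tree k.+1)) x ord0.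
  have [m] := ubnP (x : nat); elim: m x => // m IHm x ltx.
  have [->|x0] := eqVneq x ord0; first exact: connect0.
  have xpos : 0 < x by rewrite lt0n.
  have ltp := parent_lt _ xpos.
  have pk : parent x < k.+1 by apply: ltn_trans (ltn_ord x).
  apply: (@connect_trans _ _ (Ordinal pk)); last by apply: IHm => /=; lia.
  apply: connect1; rewrite /adj inE /= eqxx andbT -val_eqE /=.
  by rewrite neq_ltn ltp orbT.
apply/forallP => x; apply/forallP => y.
apply: connect_trans (to0 x) _.
by rewrite (sym_connect_sym (@adj_sym _ (tree k.+1))).
Qed.

Lemma tree_lipschitz k (f : nat -> nat) (u v : 'I_k) :
  (forall x, f x <= (f (parent x)).+1 /\ f (parent x) <= (f x).+1) ->
  f v <= f u + dist (tree k) u v.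
Proof.
move=> lipf; apply: (lipschitz_dist _ _ (tree_connected k) (fun x => f x)).
by move=> x y /(tree_adj _)[] <-; case: (lipf x) (lipf y) => ? ? [].
Qed.

Lemma tree_eqt (t k : nat) : eqt t (tree k) <= (2 * t).+1 * (n.+1 * c).
Proof.
set w := n.+1 * c; have w0 : 0 < w by rewrite muln_gt0.
apply/bigmax_leqP => S /forall_inP eqS.
have [->|[u uS]] := set_0Vmem S; first by rewrite cards0.
(* Index of the spider containing [x], that is, the position along the path of hubs. *)
pose b x := x %/ c %/ n.+1.
have lipb x : b x <= (b (parent x)).+1 /\ b (parent x) <= (b x).+1.
  rewrite /b; have [x0|/(parent_nonroot _)[-> _]] := eqVneq (x %% c) 0;
    last by lia.
  rewrite (parent_root _ x0) mulnK //; set q := x %/ c; split.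
    rewrite -ltnS ltn_divLR //; have := ltn_ceil q.-1 (ltn0Sn n).
    by move: (q.-1 %/ _) => p; nia.
  by apply: leqW; apply: leq_div2r; exact: leq_pred.
have near x : x \in S -> b x <= b u + t /\ b u <= b x + t.
  move=> xS; have [->|ux] := eqVneq x u; first by lia.
  have xu : dist (tree k) x u = t.
    by have /forall_inP/(_ u uS)/implyP/(_ ux)/eqP := eqS x xS.
  have ux' : dist (tree k) u x = t.
    have /forall_inP/(_ x xS)/implyP := eqS u uS.
    by rewrite eq_sym => /(_ ux)/eqP.
  by split; [rewrite -ux' | rewrite -xu]; exact: tree_lipschitz.
(* [S] lies in 2t + 1 consecutive blocks of [w] labels. If b u < t, the run starts at 0 and still
   covers block b u + t. *)
rewrite cardE -(size_map val) -(size_iota ((b u - t) * w) (_ * w)).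
apply: uniq_leq_size; first by rewrite (map_inj_uniq val_inj) enum_uniq.
move=> _ /mapP[x xS ->]; move: xS; rewrite mem_enum => /near[].
rewrite mem_iota /b -!divnMA ![c * _]mulnC -/w.
have := divn_eq x w; have := ltn_pmod x w0.
move: (val x %/ w) (val x %% w) (val u %/ w) => q r q' ? /= ->; nia.
Qed.

Lemma tree_alpha (s k : nat) :
  s < 2 * c -> n * (k %/ (n.+1 * c)) <= alpha s (tree k).
Proof.
move=> s_c; set K := k %/ _.
(* The successor skips position 0 of the block, which is the hub. *)
pose leg (p : 'I_K * 'I_n) := p.1 * n.+1 + p.2.+1.
have tip_lt p : leg p * c + c.-1 < k.
  have h : K * (n.+1 * c) <= k by exact: leq_trunc_div.
  have := ltn_ord p.1; have := ltn_ord p.2; rewrite /leg; nia.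
pose tip p : 'I_k := Ordinal (tip_lt p).
have tip_div p : tip p %/ c = leg p.
  by rewrite divnMDl // divn_small ?addn0 ?prednK.
have tip_mod p : tip p %% c = c.-1 by rewrite modnMDl modn_small ?prednK.
have leg_mod p : leg p %% n.+1 = p.2.+1 by rewrite modnMDl modn_small ?ltnS.
have leg_div p : leg p %/ n.+1 = p.1.
  by rewrite divnMDl // divn_small ?addn0 ?ltnS.
have leg_inj : injective leg.
  move=> p q e; have := leg_mod p; have := leg_div p.
  rewrite e leg_mod leg_div; case: p q {e} => [a i] [a' i'] /= ea [ei].
  by congr pair; apply: val_inj.
have tip_inj : injective tip.
  by move=> p q e; apply: leg_inj; rewrite -!tip_div e.
pose U := [set tip p | p in [set: 'I_K * 'I_n]]%SET.
have <- : #|U| = n * K.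
  by rewrite card_imset // cardsT card_prod !card_ord mulnC.
apply: (@leq_bigmax_cond _ _ (fun U : {set _} => #|U|)).
apply/forall_inP => _ /imsetP[p _ ->]; apply/forall_inP => _ /imsetP[q _ ->].
apply/implyP => pq; apply: (leq_trans s_c).
(* f is the distance h to the hubs, signed negatively on the leg of p and
   shifted by c; it is 1-Lipschitz because legs meet only through hubs, where
   h vanishes. *)
pose h x := if n.+1 %| x %/ c then 0 else (x %% c).+1.
pose f x := if x %/ c == leg p then c - h x else c + h x.
have lipf x : f x <= (f (parent x)).+1 /\ f (parent x) <= (f x).+1.
  rewrite /f /h; have [x0|/(parent_nonroot _)[-> ->]] := eqVneq (x %% c) 0.
    rewrite (parent_root _ x0) dvdn_mull // x0.
    by do 2!case: ifP => _; case: ifP => _; lia.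
  by do 2!case: ifP => _; lia.
have htip r : h (tip r) = c.
  by rewrite /h tip_div tip_mod /dvdn leg_mod /= prednK.
(* [f] is 0 at [tip p] and 2c at [tip q]. *)
have := @tree_lipschitz k f (tip p) (tip q) lipf.
rewrite /f !htip !tip_div eqxx (inj_eq leg_inj) -(inj_eq tip_inj) eq_sym.
by rewrite (negbTE pq); lia.
Qed.

End Tree.

(** * Bounds linear in the order *)

Lemma AE_lower (t n : nat) : 1 < t ->
  exists C, forall k, n * k <= uphalf t * n.+1 * AE k t + C.
Proof.
move=> t1; set c := uphalf t; have c0 : 0 < c by rewrite /c; lia.
set w := n.+1 * c.
(* The first term absorbs the bound on [eqt], the second the remainder of [k] modulo [w]. *)
exists (w * ((2 * t).+1 * w) + n * w) => k.
have w0 : 0 < w by rewrite muln_gt0.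
have e := tree_eqt c n c0 t k.
have s_c : t.-1 < 2 * c by rewrite /c; lia.
have a := tree_alpha c n c0 _ k s_c.
have m : alpha t.-1 (tree c n k) - eqt t (tree c n k) <= AE k t.
  apply: (@leq_bigmax_cond _ _ (fun G : sgraph 'I_k => alpha t.-1 G - eqt t G)).
  exact: tree_connected.
have kE := divn_eq k w; have r := ltn_pmod k w0.
have : n * (k %/ w) <= AE k t + (2 * t).+1 * w by rewrite -/w in e a; lia.
rewrite (mulnC c) -/w; move: (k %/ w) (k %% w) kE r => q r -> rw h.
nia.
Qed.

Definition max_alpha (k t : nat) : nat :=
  \max_(G : sgraph 'I_k | gconnected G) alpha t.-1 G.

Lemma AE_le_max_alpha k t : AE k t <= max_alpha k t.
Proof.
apply/bigmax_leqP => G cG; apply: leq_trans (leq_subr _ _) _.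
exact: (@leq_bigmax_cond _ _ (fun G : sgraph 'I_k => alpha t.-1 G)).
Qed.

Lemma max_alpha_upper k t : 0 < t -> uphalf t * max_alpha k t <= k + uphalf t.
Proof.
move=> t0; have c0 : 0 < uphalf t by lia.
rewrite mulnC -leq_divRL //; apply/bigmax_leqP => G cG.
by rewrite leq_divRL //; have := alpha_upper _ _ cG t t0; rewrite card_ord.
Qed.

(** * Passage to the limit *)

Local Open Scope ring_scope.

Lemma cvg_ratio (R : realType) (c : nat) (A : nat -> nat) :
  (0 < c)%N ->
  (forall k, (c * A k <= k + c)%N) ->
  (forall n, exists C, forall k, (n * k <= c * n.+1 * A k + C)%N) ->
  (A k)%:R / k%:R @[k --> \oo] --> (c%:R^-1 : R).
Proof.
move=> c0 upA lowA; apply/cvgrPdist_le => e e0.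
(* As [C] depends on [n], [n] is fixed before [k] grows. Then (n + 1)(x - c a) <= x + C < 2x < (n +
   1) e x. *)
have [n n_e] : exists n : nat, 2 / e < n.+1%:R.
  by exists (Num.truncn (2 / e)); rewrite truncnS_gt.
have [C lowC] := lowA n.
near=> k.
have k0 : (0 < k%:R :> R) by near: k; exact: nbhs_infty_gtr.
have k_e : 1 / e < k%:R by near: k; exact: nbhs_infty_gtr.
have k_C : C%:R < k%:R :> R by near: k; exact: nbhs_infty_gtr.
have := upA k; have := lowC k.
rewrite -!(ler_nat R) !(natrM, natrD) => low up.
have c1 : 1 <= c%:R :> R by rewrite ler1n.
move: n_e k_e; rewrite !ltr_pdivrMr // -natr1 => n_e k_e.
rewrite -natr1 in low.
set a : R := (A k)%:R in low up *; set x : R := k%:R in low up k0 k_e k_C *.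
have -> : c%:R^-1 - a / x = (x - c%:R * a) / (c%:R * x).
  by field; rewrite !gt_eqF //; lra.
have cx0 : 0 < c%:R * x by apply: mulr_gt0 => //; lra.
rewrite ler_norml ler_pdivlMr // ler_pdivrMr //; apply/andP.
(* Here x - c a >= -c and e x > 1. *)
split; first by nra.
have n0 : 0 <= n%:R :> R by exact: ler0n.
have : (n%:R + 1) * (x - c%:R * a) <= (n%:R + 1) * (e * x) by nra.
rewrite ler_pM2l; last by lra.
by move=> h; apply: le_trans h _; nra.
Unshelve. all: by end_near.
Qed.

(** Division by x >= 0 is monotone and fixes 0, so it commutes with the maximum; x = 0 covers order
    0. *)
Lemma bigmax_natr_div (R : realType) (I : finType) (P : pred I) (F : I -> nat)
    (x : R) :
  0 <= x ->
  \big[Num.max/0]_(i | P i) ((F i)%:R / x) = (\max_(i | P i) F i)%:R / x.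
Proof.
move=> x0; apply/esym/(big_morph (fun m : nat => m%:R / x));
  last by rewrite mul0r.
move=> a b; rewrite -maxr_pMl ?invr_ge0 //; congr (_ / _).
by rewrite natr_max.
Qed.

Theorem theorem12 (R : realType) (t : nat) (ht : (2 <= t)%N) :
  let ratioAE : nat -> R := fun k => (AE k t)%:R / k%:R in
  let ratioAlpha : nat -> R := fun k =>
    \big[Num.max/0]_(G : sgraph 'I_k | gconnected G)
      ((alpha t.-1 G)%:R / k%:R) in
  [/\ cvg (ratioAE k @[k --> \oo]),
      cvg (ratioAlpha k @[k --> \oo])
    & lim (ratioAE k @[k --> \oo]) = lim (ratioAlpha k @[k --> \oo])].
Proof.
move=> ratioAE ratioAlpha.
have c0 : (0 < uphalf t)%N by lia.
have t0 : (0 < t)%N by lia.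
(* Since [AE] is at most [max_alpha], the lower bound for [AE] and the upper bound for [max_alpha]
   apply to both sequences. *)
have cvgAE : ratioAE k @[k --> \oo] --> ((uphalf t)%:R^-1 : R).
  apply: cvg_ratio => // [k|n]; last exact: AE_lower.
  apply: leq_trans (max_alpha_upper k t t0).
  by rewrite leq_mul2l AE_le_max_alpha orbT.
have cvgAlpha : ratioAlpha k @[k --> \oo] --> ((uphalf t)%:R^-1 : R).
  have -> : ratioAlpha = fun k => (max_alpha k t)%:R / k%:R.
    by apply/funext => k; exact: bigmax_natr_div.
  apply: cvg_ratio => // [k|n]; first exact: max_alpha_upper.
  have [C hC] := AE_lower t n ht; exists C => k; apply: leq_trans (hC k) _.
  by rewrite leq_add2r leq_mul2l AE_le_max_alpha orbT.
split; [exact: cvgP cvgAE | exact: cvgP cvgAlpha |].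
by rewrite (cvg_lim _ cvgAE) // (cvg_lim _ cvgAlpha).
Qed.
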